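(* Let $0<\epsilon<1/4$. Suppose that $Y$ is the Stone-Čech compactification of a discrete space with at least two points, and that $X$ is a finite (Hausdorff, hence discrete) space with at least two points. Let $T:C(X)\to C(Y)$ be an $\epsilon$-disjointness preserving operator with $\|T\|=1$. Then there exists a weighted composition map $S:C(X)\to C(Y)$ such that $\|T-S\|\le o'_X(\epsilon)$.
   Context: $\mathbb{K}$ denotes $\mathbb{R}$ or $\mathbb{C}$. For a compact Hausdorff space $Z$, $C(Z)$ is the Banach space of $\mathbb{K}$-valued continuous functions on $Z$ with the sup norm $\|\cdot\|_\infty$; norms of operators are operator norms. For $\epsilon>0$, an operator $T:C(X)\to C(Y)$ is $\epsilon$-disjointness preserving if it is linear, continuous, and $\|(Tf)(Tg)\|_\infty\le\epsilon$ whenever $f,g\in C(X)$ satisfy $\|f\|_\infty=\|g\|_\infty=1$ and $fg\equiv 0$. An operator $S:C(X)\to C(Y)$ is a weighted composition map if there exist $a\in C(Y)$ and a map $h:Y\to X$, continuous on $c(a):=\{y\in Y:a(y)\ne 0\}$, such that $(Sf)(y)=a(y)f(h(y))$ for every $f\in C(X)$ and $y\in Y$ (the case $S\equiv 0$ is included). For $n\in\mathbb{N}$ put $\omega_n:=\frac{n^2-1}{4n^2}$. For a finite set $X$ with $n\ge 2$ points, $o'_X:(0,1/4)\to\mathbb{R}$ is defined by: $o'_X(\epsilon):=2\sqrt{\frac{(n-1)\epsilon}{n+1}}$ if $n$ is odd and $\epsilon\le\omega_n$; $o'_X(\epsilon):=\frac{n-1}{n}$ if $n$ is odd and $\epsilon>\omega_n$;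 $o'_X(\epsilon):=\frac{2(n-1)\sqrt{\epsilon}}{n}$ if $n$ is even. *)

(* Defs.v *)
From HB Require Import structures.
From mathcomp Require Import all_boot all_order all_algebra.
From mathcomp Require Import complex.
From mathcomp Require Import all_classical all_reals all_analysis.

Set Implicit Arguments.
Unset Strict Implicit.
Unset Printing Implicit Defensive.

Import Order.TTheory GRing.Theory Num.Theory.
Import numFieldNormedType.Exports.

Local Open Scope classical_set_scope.
Local Open Scope ring_scope.

Variant scalar_kind := RealScalars | ComplexScalars.

Definition scalar_field (R : realType) (k : scalar_kind) : numFieldType :=
  match k with RealScalars => R | ComplexScalars => R[i] end.

Definition of_real (R : realType) (k : scalar_kind) : R -> scalar_field R k :=
  match k with RealScalars => id | ComplexScalars => real_complex R end.

Definition real_part (R : realType) (k : scalar_kind) : scalar_field R k -> R :=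
  match k with RealScalars => id | ComplexScalars => @complex.Re R end.

(* The norm of a [numFieldType] takes values in the field itself; [modulus] is
   its counterpart with values in R (see [of_real_modulus]). *)
Definition modulus (R : realType) (k : scalar_kind) (x : scalar_field R k) : R :=
  real_part `|x|.

Section Modulus.
Context {R : realType} {k : scalar_kind}.
Implicit Types x y : scalar_field R k.

Lemma of_real_modulus x : of_real k (modulus x) = `|x|.
Proof. by case: k x => //= -[a b]. Qed.

Lemma of_realD (r s : R) : of_real k (r + s) = of_real k r + of_real k s.
Proof. by case: k => //=; rewrite rmorphD. Qed.

Lemma of_realM (r s : R) : of_real k (r * s) = of_real k r * of_real k s.
Proof. by case: k => //=; rewrite rmorphM. Qed.

Lemma of_real0 : of_real k (0 : R) = 0.
Proof. by case: k. Qed.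

Lemma of_real_le (r s : R) : (of_real k r <= of_real k s) = (r <= s).
Proof. by case: k => //=; rewrite lecR. Qed.

Lemma of_real_inj : injective (of_real k : R -> scalar_field R k).
Proof. by move=> r s /eqP; rewrite eq_le !of_real_le -eq_le => /eqP. Qed.

Lemma modulus_ge0 x : 0 <= modulus x.
Proof. by rewrite -of_real_le of_real_modulus of_real0. Qed.

Lemma ler_modulusD x y : modulus (x + y) <= modulus x + modulus y.
Proof. by rewrite -of_real_le of_realD !of_real_modulus ler_normD. Qed.

Lemma modulusM x y : modulus (x * y) = modulus x * modulus y.
Proof. by apply: of_real_inj; rewrite of_realM !of_real_modulus normrM. Qed.

Lemma modulus_eq0 x : modulus x = 0 -> x = 0.
Proof.
by move=> x0; apply/normr0_eq0; rewrite -of_real_modulus x0 of_real0.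
Qed.

Lemma modulusN x : modulus (- x) = modulus x.
Proof. by apply: (@of_real_inj); rewrite !of_real_modulus normrN. Qed.

Lemma modulus_continuous : continuous (@modulus R k : scalar_field R k -> R^o).
Proof.
move=> x; have F : Filter (nbhs x) by exact: nbhs_filter.
apply/cvgrPdist_lt => e e0.
have e0' : 0 < of_real k e.
  by rewrite lt_neqAle -of_real0 of_real_le ltW// (inj_eq of_real_inj) lt_eqF.
near=> y.
have xy : modulus (x - y) < e.
  have : `|x - y| < of_real k e.
    by near: y; exact: (nbhsx_ballx x (of_real k e) e0').
  by rewrite !lt_neqAle -of_real_modulus (inj_eq of_real_inj) of_real_le.
have le_sub (u v : scalar_field R k) : modulus u <= modulus v + modulus (u - v).
  by rewrite [leRHS]addrC (le_trans _ (ler_modulusD _ _))// subrK.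
apply: le_lt_trans xy; rewrite ler_norml lerBlDl le_sub andbT.
by rewrite lerBrDl lerBlDr -[modulus (x - y)]modulusN opprB le_sub.
Unshelve. all: by end_near. Qed.

End Modulus.

HB.mixin Record isCompactHausdorff T & Topological T := {
  compact_setT : compact [set: T];
  hausdorffT : hausdorff_space T
}.

#[short(type="compactHausdorffType")]
HB.structure Definition CompactHausdorff :=
  {T of Topological T & isCompactHausdorff T}.

(* C(Z) over R or C. Its topology is the one of the sup norm, given by the
   normed module structure below. *)
Definition cfun (R : realType) (k : scalar_kind) (Z : compactHausdorffType) :=
  continuousType Z (scalar_field R k).

Section ContinuousFunctions.
Context {R : realType} {k : scalar_kind} {Z : compactHausdorffType}.
Local Notation K := (scalar_field R k).
Local Notation C := (cfun R k Z).

HB.instance Definition _ := gen_eqMixin C.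
HB.instance Definition _ := gen_choiceMixin C.

Definition cfun_of (f : Z -> K) (fc : continuous f) : C :=
  (mkcts fc : continuousType Z K).

Lemma cfunP (f g : C) : (forall z, f z = g z) -> f = g.
Proof. by move=> fg; apply/continuousEP. Qed.

Lemma cfun_continuous (f : C) : continuous (f : Z -> K).
Proof. exact: cts_fun. Qed.

Definition cfun_cst (c : K) : C := cfun_of (@cst_continuous Z K c).

Lemma cfun_opp_subproof (f : C) : continuous (fun z => - f z).
Proof. by move=> z; apply: cvgN; exact: cfun_continuous. Qed.

Lemma cfun_add_subproof (f g : C) : continuous (fun z => f z + g z).
Proof. by move=> z; apply: cvgD; exact: cfun_continuous. Qed.

Lemma cfun_mul_subproof (f g : C) : continuous (fun z => f z * g z).
Proof. by move=> z; apply: cvgM; exact: cfun_continuous. Qed.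

Definition cfun_opp (f : C) : C := cfun_of (@cfun_opp_subproof f).
Definition cfun_add (f g : C) : C := cfun_of (@cfun_add_subproof f g).
Definition cfun_mul (f g : C) : C := cfun_of (@cfun_mul_subproof f g).

Fact cfun_addA : associative cfun_add.
Proof. by move=> f g h; apply: cfunP => z; exact: addrA. Qed.
Fact cfun_addC : commutative cfun_add.
Proof. by move=> f g; apply: cfunP => z; exact: addrC. Qed.
Fact cfun_add0 : left_id (cfun_cst 0) cfun_add.
Proof. by move=> f; apply: cfunP => z; exact: add0r. Qed.
Fact cfun_addN : left_inverse (cfun_cst 0) cfun_opp cfun_add.
Proof. by move=> f; apply: cfunP => z; exact: addNr. Qed.

HB.instance Definition _ := GRing.isZmodule.Build C
  cfun_addA cfun_addC cfun_add0 cfun_addN.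

Fact cfun_mulA : associative cfun_mul.
Proof. by move=> f g h; apply: cfunP => z; exact: mulrA. Qed.
Fact cfun_mulC : commutative cfun_mul.
Proof. by move=> f g; apply: cfunP => z; exact: mulrC. Qed.
Fact cfun_mul1 : left_id (cfun_cst 1) cfun_mul.
Proof. by move=> f; apply: cfunP => z; exact: mul1r. Qed.
Fact cfun_mulDl : left_distributive cfun_mul +%R.
Proof. by move=> f g h; apply: cfunP => z; exact: mulrDl. Qed.

HB.instance Definition _ := GRing.Zmodule_isComPzRing.Build C
  cfun_mulA cfun_mulC cfun_mul1 cfun_mulDl.

Definition cfun_scale (c : K) (f : C) : C := cfun_mul (cfun_cst c) f.

Fact cfun_scaleA c d f : cfun_scale c (cfun_scale d f) = cfun_scale (c * d) f.
Proof. by apply: cfunP => z; exact: mulrA. Qed.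
Fact cfun_scale1 : left_id 1 cfun_scale.
Proof. by move=> f; apply: cfunP => z; exact: mul1r. Qed.
Fact cfun_scaleDr : right_distributive cfun_scale +%R.
Proof. by move=> c f g; apply: cfunP => z; exact: mulrDr. Qed.
Fact cfun_scaleDl f : {morph cfun_scale^~ f : c d / c + d}.
Proof. by move=> c d; apply: cfunP => z; exact: mulrDl. Qed.

HB.instance Definition _ := GRing.Zmodule_isLmodule.Build K C
  cfun_scaleA cfun_scale1 cfun_scaleDr cfun_scaleDl.

Definition supnorm (f : C) : R := sup [set modulus (f z) | z in [set: Z]].

Lemma cfun_bounded (f : C) :
  has_ubound [set modulus (f z) | z in [set: Z]].
Proof.
have fc : {within [set: Z], continuous (fun z => modulus (f z) : R^o)}.
  apply: continuous_subspaceT => z.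
  by apply: continuous_comp; [exact: cfun_continuous|exact: modulus_continuous].
have [M [Mr MP]] := compact_bounded (continuous_compact fc compact_setT).
exists (M + 1) => _ [z _ <-].
apply: le_trans (ler_norm _) _.
by apply: (MP (M + 1)); [rewrite ltrDl ltr01|exists z].
Qed.

Lemma modulus_le_supnorm (f : C) z : modulus (f z) <= supnorm f.
Proof. by apply: ub_le_sup; [exact: cfun_bounded|exists z]. Qed.

Lemma supnorm_ge0 (f : C) : 0 <= supnorm f.
Proof.
have [A0|/set0P[_ [z _ _]]] := eqVneq [set modulus (f z) | z in [set: Z]] set0.
  by rewrite /supnorm A0 sup0.
exact: le_trans (modulus_ge0 (f z)) (modulus_le_supnorm f z).
Qed.

Lemma supnorm_le (f : C) (r : R) : 0 <= r ->
  (forall z, modulus (f z) <= r) -> supnorm f <= r.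
Proof.
move=> r0 fr; rewrite /supnorm.
have [->|A0] := eqVneq [set modulus (f z) | z in [set: Z]] set0.
  by rewrite sup0.
by apply: ge_sup => [|_ [z _ <-]]; [exact/set0P|exact: fr].
Qed.

Definition cfun_norm (f : C) : K := of_real k (supnorm f).

Fact ler_cfun_normD f g : cfun_norm (f + g) <= cfun_norm f + cfun_norm g.
Proof.
rewrite /cfun_norm -of_realD of_real_le; apply: supnorm_le.
  by rewrite addr_ge0 ?supnorm_ge0.
move=> z; apply: (le_trans (ler_modulusD _ _)).
by rewrite lerD// modulus_le_supnorm.
Qed.

Fact cfun_normZ (c : K) f : cfun_norm (c *: f) = `|c| * cfun_norm f.
Proof.
have le_normZ (d : K) (g : C) : supnorm (d *: g) <= modulus d * supnorm g.
  apply: supnorm_le => [|z]; first by rewrite mulr_ge0 ?modulus_ge0 ?supnorm_ge0.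
  by rewrite modulusM ler_wpM2l ?modulus_ge0 ?modulus_le_supnorm.
rewrite -of_real_modulus /cfun_norm -of_realM; congr of_real.
apply/eqP; rewrite eq_le le_normZ /=.
have [->|c0] := eqVneq c 0.
  have -> : modulus (0 : K) = 0.
    by apply: (@of_real_inj R k); rewrite of_real_modulus normr0 of_real0.
  by rewrite mul0r supnorm_ge0.
have m0 : 0 < modulus c.
  rewrite lt_def modulus_ge0 andbT; apply: contra c0 => /eqP /modulus_eq0 ->.
  by rewrite eqxx.
rewrite -{1}[f]scale1r -(mulVf c0) -scalerA.
apply: le_trans (ler_wpM2l (ltW m0) (le_normZ _ _)) _.
rewrite mulrA -modulusM divff//.
have -> : modulus (1 : K) = 1.
  by apply: (@of_real_inj R k); rewrite of_real_modulus normr1; case: (k).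
by rewrite mul1r.
Qed.

Fact cfun_norm_eq0 f : cfun_norm f = 0 -> f = 0.
Proof.
rewrite /cfun_norm -of_real0 => /of_real_inj f0.
apply: cfunP => z; apply: modulus_eq0; apply/eqP.
by rewrite eq_le modulus_ge0 andbT -f0 modulus_le_supnorm.
Qed.

HB.instance Definition _ := Lmodule_isNormed.Build K C
  ler_cfun_normD cfun_normZ cfun_norm_eq0.

Lemma normr_cfunE (f : C) : `|f| = of_real k (supnorm f).
Proof. by []. Qed.

End ContinuousFunctions.

Section Operators.
Context {R : realType} {k : scalar_kind} {X Y : compactHausdorffType}.
Local Notation CX := (cfun R k X).
Local Notation CY := (cfun R k Y).

(* [sup] is 0 on unbounded sets: this is the operator norm of bounded maps. *)
Definition opnorm (T : CX -> CY) : R :=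
  sup [set supnorm (T f) | f in [set f | supnorm f <= 1]].

Definition disjointness_preserving (eps : R) (T : {linear CX -> CY}) : Prop :=
  continuous T /\
  forall f g : CX, supnorm f = 1 -> supnorm g = 1 -> f * g = 0 ->
    supnorm (T f * T g) <= eps.

Definition weighted_composition (S : CX -> CY) : Prop :=
  exists (a : CY) (h : Y -> X),
    {within [set y | a y != 0], continuous h} /\
    forall (f : CX) (y : Y), S f y = a y * f (h y).

End Operators.

(* The first two conditions say that i is a homeomorphism onto its range; the
   extension g is unique because the range is dense. *)
Definition is_stone_cech (D : topologicalType) (Y : compactHausdorffType)
    (i : D -> Y) : Prop :=
  [/\ injective i,
      forall U : set D,
        open U <-> exists2 V : set Y, open V & i @^-1` V = U,
      dense (range i) &
      forall (Z : compactHausdorffType) (f : D -> Z), continuous f ->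
        exists2 g : Y -> Z, continuous g & g \o i = f].

Section Bound.
Context {R : realType}.

Definition omega (n : nat) : R := (n%:R ^+ 2 - 1) / (4 * n%:R ^+ 2).

(* The function o'_X of a finite set X with n points, on (0, 1/4). *)
Definition o_prime (n : nat) (eps : R) : R :=
  if odd n then
    if eps <= omega n then 2 * Num.sqrt ((n%:R - 1) * eps / (n%:R + 1))
    else (n%:R - 1) / n%:R
  else 2 * (n%:R - 1) * Num.sqrt eps / n%:R.

End Bound.

(* Main.v *)
(* Write w_x(y) = |T(1_x)(y)|. At each y the weights have sum s <= 1, and testing
   T on functions of modulus 1 supported in A and in its complement gives
   w(A) w(A^c) <= eps for every subset A of X. Choosing A as balanced as possible
   (always |w(A) - w(A^c)| <= max w; for n even also |A| = n/2) bounds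
   s - max w by o'_X(eps). On the discrete space D let h pick a point of maximal
   weight; X being finite, h extends continuously to Y, and
   S f y = T(1_(h y))(y) f(h y) is within s - max w of T f on the dense set D. *)
From HB Require Import structures.
Require Import Defs.
From mathcomp Require Import all_boot all_order all_algebra.
From mathcomp Require Import all_classical all_reals all_analysis.
From mathcomp Require Import ring lra.

Import Order.TTheory GRing.Theory Num.Theory.
Import numFieldNormedType.Exports.

Local Open Scope classical_set_scope.
Local Open Scope ring_scope.

(** * Splitting a finite family of weights into two nearly equal parts *)

Lemma sum_setC {R : realDomainType} {I : finType} (w : I -> R) (A : {set I}) :
  \sum_j w j = \sum_(j in A) w j + \sum_(j in ~: A) w j.
Proof.
by rewrite (bigID (mem A))/=; congr (_ + _); apply: eq_bigl => j; rewrite inE.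
Qed.

(** Greedy signing: each new weight gets the sign opposite to that of the signed sum already formed,
    so the sum never leaves [[-m, m]]. *)
Lemma balanced_partition {R : realDomainType} {I : finType} (w : I -> R)
    (m : R) : 0 <= m -> (forall j, 0 <= w j <= m) ->
  exists A : {set I},
    `|\sum_(j in A) w j - \sum_(j in ~: A) w j| <= m.
Proof.
move=> m0 wm.
suff [b hb] : exists b : I -> bool,
    `|\sum_j (if b j then w j else - w j)| <= m.
  exists (finset b); congr (`|_| <= _): hb.
  rewrite (bigID b)/= -sumrN; congr (_ + _).
    by apply: eq_big => [j|j ->]; rewrite ?inE.
  by apply: eq_big => [j|j /negbTE ->]; rewrite ?inE.
(* Uniqueness of the enumeration is carried along so that resetting the sign at [x] leaves the sum
   over [s] unchanged. *)
elim: (index_enum I) (index_enum_uniq I) => [_|x s IH /= /andP[xs us]].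
  by exists (fun=> true); rewrite big_nil normr0.
have [b hb] := IH us.
set t := \sum_(j <- s) _ in hb.
exists (fun j => if j == x then t <= 0 else b j).
rewrite big_cons eqxx (_ : \sum_(j <- s) _ = t); last first.
  apply: eq_big_seq => j js; case: eqP => // jx.
  by rewrite -jx js in xs.
have := wm x; move: hb; rewrite !ler_norml.
by case: ifP => t0; [|move/negbT: t0; rewrite -ltNge => t0] => *; lra.
Qed.

(** Any [A] with half of the indices works: each half weighs at most [#|I|/2 * m], and the
    difference is twice the weight of one half minus the total. *)
Lemma half_partition {R : realDomainType} {I : finType} (w : I -> R)
    (m : R) : ~~ odd #|I| -> (forall j, w j <= m) ->
  exists A : {set I},
    `|\sum_(j in A) w j - \sum_(j in ~: A) w j| <= #|I|%:R * m - \sum_j w j.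
Proof.
move=> evI wm; pose A := [set x in take #|I|./2 (enum I)]%SET.
have cA : #|A| = #|I|./2.
  rewrite cardsE (card_uniqP _) ?take_uniq ?enum_uniq// size_takel// -cardE.
  by rewrite -divn2 leq_div.
have cI : #|I| = (#|I|./2 + #|I|./2)%N.
  by rewrite addnn halfK (negbTE evI) subn0.
have cA' : #|~: A| = #|I|./2 by rewrite cardsCs finset.setCK cA {1}cI addnK.
exists A; rewrite (sum_setC w A) cI natrD mulrDl ler_norml.
have le_sum (B : {set I}) : \sum_(j in B) w j <= #|B|%:R * m.
  by rewrite mulr_natl -sumr_const; apply: ler_sum.
have := le_sum A; have := le_sum (~: A); rewrite cA cA'.
by move: (_%:R * m) => *; lra.
Qed.

Lemma sum_sub_max_le {R : realType} {I : finType} (w : I -> R) (eps : R)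
    (j : I) : (2 <= #|I|)%N -> (forall l, 0 <= w l <= w j) ->
  \sum_l w l <= 1 ->
  (forall A : {set I}, (\sum_(l in A) w l) * (\sum_(l in ~: A) w l) <= eps) ->
  \sum_l w l - w j <= o_prime #|I| eps.
Proof.
move=> n2 wj s1 prodle.
set s := \sum_l w l; set m := w j; set n : R := #|I|%:R.
rewrite -/s in s1.
have n2R : 2 <= n by rewrite /n (ler_nat R 2).
have m0 : 0 <= m by case/andP: (wj j).
have snm : s <= n * m.
  rewrite /n mulr_natl -sumr_const; apply: ler_sum => l _.
  by case/andP: (wj l).
have ms : m <= s.
  rewrite /s (bigD1 j)//= lerDl; apply: sumr_ge0 => l _.
  by case/andP: (wj l).
(* If the two parts have weights [P] and [Q], then [s^2 - (P - Q)^2 = 4PQ]. *)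
have gap (A : {set I}) (d : R) :
    `|\sum_(l in A) w l - \sum_(l in ~: A) w l| <= d ->
    s ^+ 2 - d ^+ 2 <= 4 * eps.
  have := prodle A; rewrite /s (sum_setC w A) ler_norml => H /andP[H1 H2].
  nra.
have gap_m : s ^+ 2 - m ^+ 2 <= 4 * eps.
  by have [A /gap] := balanced_partition _ _ m0 wj.
have eps0 : 0 <= eps by have := prodle finset.set0; rewrite big_set0 mul0r.
have sub0 : 0 <= s - m by rewrite subr_ge0.
rewrite /o_prime -/n; case: ifPn => oddI.
  case: ifP => _; last first.
    (* For large [eps] the bound follows from [m >= s / n] and [s <= 1] alone. *)
    have n1s : 0 <= (n - 1) * (1 - s) by rewrite mulr_ge0//; lra.
    by rewrite ler_pdivlMr; lra.
  have q0 : 0 <= (n - 1) * eps / (n + 1).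
    by rewrite divr_ge0 ?mulr_ge0//; lra.
  have H : (s - m) ^+ 2 <= 2 ^+ 2 * ((n - 1) * eps / (n + 1)).
    rewrite mulrA ler_pdivlMr; last lra.
    (* Twice this product is [(n - 1)(s^2 - m^2) - (n + 1)(s - m)^2]. *)
    have : 0 <= (s - m) * (n * m - s) by rewrite mulr_ge0//; lra.
    have : (n - 1) * (s ^+ 2 - m ^+ 2) <= (n - 1) * (4 * eps).
      by rewrite ler_wpM2l//; lra.
    lra.
  move: H; rewrite -ler_sqrt; last by rewrite mulr_ge0 ?sqr_ge0.
  by rewrite sqrtr_sqr sqrtrM ?sqr_ge0// sqrtr_sqr !ger0_norm.
have [A /gap gap_n] := half_partition _ _ oddI (fun l => (andP (wj l)).2).
rewrite -/n -/s in gap_n.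
have r0 := sqrtr_ge0 eps; have := sqr_sqrtr eps0.
move: (Num.sqrt eps) r0 => r r0 r2.
rewrite ler_pdivlMr; last lra.
suff : ((s - m) * n) ^+ 2 <= (2 * (n - 1) * r) ^+ 2.
  by rewrite ler_sqr ?nnegrE ?mulr_ge0//; lra.
rewrite [leRHS]exprMn r2.
set u := n * m - s in gap_n.
have u0 : 0 <= u by rewrite /u; lra.
(* The two disjuncts come from a partition into equally many indices, good
   when the weights are nearly uniform, and from [balanced_partition]. *)
suff : ((s - m) * n) ^+ 2 <= (n - 1) ^+ 2 * (s ^+ 2 - u ^+ 2) \/
       ((s - m) * n) ^+ 2 <= (n - 1) ^+ 2 * (s ^+ 2 - m ^+ 2).
  have : 0 <= (n - 1) ^+ 2 by rewrite sqr_ge0.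
  by move=> ? []; nra.
have -> : (s - m) * n = (n - 1) * s - u by rewrite /u; ring.
(* The threshold [n u = s] amounts to [(n + 1) s = n^2 m]. Below it the first disjunct holds:
   expanded, it is [H] multiplied by [u]. *)
have [us|us] := lerP (n * u) s.
  have H : u * (1 + (n - 1) ^+ 2) <= 2 * (n - 1) * s.
    have le1 : (n * u) * (1 + (n - 1) ^+ 2) <= s * (1 + (n - 1) ^+ 2).
      by rewrite ler_wpM2r// addr_ge0 ?sqr_ge0.
    have le2 : 0 <= s * (n ^+ 2 - 2) by rewrite mulr_ge0//; [lra|nra].
    have n0 : 0 < n by lra.
    rewrite -(ler_pM2l n0); lra.
  by left; have := ler_wpM2l u0 H; lra.
right.
have -> : (n - 1) * s - u = n * (s - m) by rewrite /u; ring.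
(* The second disjunct is this inequality multiplied by [s - m]. *)
have H : n ^+ 2 * (s - m) <= (n - 1) ^+ 2 * (s + m).
  have nm : (n + 1) * s <= n ^+ 2 * m by rewrite /u in us; nra.
  have le1 : (n + 1) * s * (2 * n ^+ 2 - 2 * n + 1) <=
         n ^+ 2 * m * (2 * n ^+ 2 - 2 * n + 1) by rewrite ler_wpM2r//; nra.
  have le2 : 0 <= s * (n ^+ 2 - n + 1) by rewrite mulr_ge0//; [lra|nra].
  have n20 : 0 < n ^+ 2 by rewrite exprn_gt0//; lra.
  rewrite -(ler_pM2l n20); lra.
by have := ler_wpM2l sub0 H; lra.
Qed.

(** * Discreteness of finite Hausdorff spaces, and moduli of scalars *)

Lemma finite_hausdorff_open (X : topologicalType) (A : set X) :
  hausdorff_space X -> finite_set [set: X] -> open A.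
Proof.
move=> hausX finX; rewrite -[A]setCK; apply: closed_openC.
move/hausdorff_accessible/accessible_finite_set_closed: hausX; apply.
exact: sub_finite_set finX.
Qed.

Section Scalars.
Context {R : realType} {k : scalar_kind}.
Local Notation K := (scalar_field R k).

Lemma modulus_of_real (r : R) : 0 <= r -> modulus (of_real k r) = r.
Proof.
move=> r0; apply: (@of_real_inj R k).
by rewrite of_real_modulus ger0_norm// -of_real0 of_real_le.
Qed.

Lemma of_real1 : of_real k (1 : R) = 1.
Proof. by case: k. Qed.

Lemma modulus0 : modulus (0 : K) = 0.
Proof. by rewrite -of_real0 modulus_of_real. Qed.

Lemma of_real_sum (I : Type) (s : seq I) (P : pred I) (w : I -> R) :
  of_real k (\sum_(j <- s | P j) w j) = \sum_(j <- s | P j) of_real k (w j).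
Proof. exact: (big_morph _ of_realD of_real0). Qed.

Lemma ler_modulus_sum (I : Type) (s : seq I) (P : pred I) (z : I -> K) :
  modulus (\sum_(j <- s | P j) z j) <= \sum_(j <- s | P j) modulus (z j).
Proof.
elim/big_rec2 : _ => [|j x y _ le]; first by rewrite modulus0.
exact: le_trans (ler_modulusD _ _) (lerD _ _).
Qed.

Lemma conj_phase_exists (z : K) :
  exists2 u : K, modulus u = 1 & z * u = of_real k (modulus z).
Proof.
have [->|z0] := eqVneq z 0.
  exists 1; first by rewrite -of_real1 modulus_of_real.
  by rewrite modulus0 mul0r of_real0.
exists (`|z| / z); last by rewrite of_real_modulus mulrC divfK.
apply: (@of_real_inj R k).
rewrite of_real_modulus of_real1 normrM normrV ?unitfE// normr_id.
by rewrite divff ?normr_eq0.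
Qed.

End Scalars.

(** * Weighted composition maps and operator norm estimates *)

Section WeightedComposition.
Context {R : realType} {k : scalar_kind} {X Y : compactHausdorffType}.
Local Notation K := (scalar_field R k).
Local Notation CX := (cfun R k X).
Local Notation CY := (cfun R k Y).

Lemma cfun_sumE (I : Type) (s : seq I) (P : pred I) (F : I -> CX) x :
  (\sum_(j <- s | P j) F j) x = \sum_(j <- s | P j) F j x.
Proof. exact: (big_morph (fun f : CX => f x)). Qed.

Lemma cfun_comp_continuous (h : Y -> X) (hc : continuous h) (f : CX) :
  continuous (fun y => f (h y)).
Proof.
by move=> y; apply: continuous_comp; [exact: hc|exact: cfun_continuous].
Qed.

(** Continuity of [h] on all of [Y] is what the Stone-Čech extension provides. *)
Definition wcomp (a : CY) (h : Y -> X) (hc : continuous h) (f : CX) : CY :=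
  a * cfun_of (cfun_comp_continuous h hc f).

Fact wcomp_is_linear a h hc : linear (wcomp a h hc).
Proof.
move=> c f g; apply: cfunP => y.
by rewrite -[LHS]/(a y * (c * f (h y) + g (h y))) mulrDr mulrCA.
Qed.

HB.instance Definition _ a h hc :=
  GRing.isLinear.Build K CX CY _ (wcomp a h hc) (wcomp_is_linear a h hc).

Lemma wcomp_weighted_composition a h hc :
  weighted_composition (wcomp a h hc).
Proof. by exists a, h; split => //; exact: continuous_subspaceT. Qed.

(** Since [sup] is 0 on sets without a supremum, [opnorm T != 0] certifies that the norms of the
    images of the unit ball are bounded. *)
Lemma supnorm_le_opnorm (T : CX -> CY) (f : CX) :
  opnorm T != 0 -> supnorm f <= 1 -> supnorm (T f) <= opnorm T.
Proof.
move=> T0 f1; apply: ub_le_sup; last by exists f.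
by apply: contrapT => nub; case/eqP: T0; apply: sup_out => -[].
Qed.

Lemma opnorm_le (T : CX -> CY) (c : R) : 0 <= c ->
  (forall f y, supnorm f <= 1 -> modulus (T f y) <= c) -> opnorm T <= c.
Proof.
move=> c0 Tc; rewrite /opnorm; set E := (X in sup X).
have [->|E0] := eqVneq E set0; first by rewrite sup0.
apply: ge_sup => [|_ [f f1 <-]]; first exact/set0P.
by apply: supnorm_le => // y; exact: Tc.
Qed.

Lemma dense_modulus_le (F : CX) (B : set X) (c : R) : dense B ->
  (forall x, B x -> modulus (F x) <= c) -> forall x, modulus (F x) <= c.
Proof.
move=> denB Bc x; rewrite leNgt; apply/negP => cx.
have Fo : open [set x | c < modulus (F x)].
  have /continuousP Fc : continuous (fun x => modulus (F x) : R^o).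
    move=> z; apply: continuous_comp; first exact: cfun_continuous.
    exact: modulus_continuous.
  exact: (Fc [set r | c < r] (@open_gt _ c)).
have [z [/= cz /Bc]] := denB _ (ex_intro _ x cx) Fo.
by rewrite leNgt cz.
Qed.

End WeightedComposition.

(** * Operators on C(X) for a finite discrete X *)

Section FiniteDomain.
Context {R : realType} {k : scalar_kind} {X Y : compactHausdorffType}.
Context {I : finType} {pt : I -> X} {ix : X -> I}.
Context (ptK : cancel pt ix) (ixK : cancel ix pt).
Context (openX : forall A : set X, open A).
Local Notation K := (scalar_field R k).
Local Notation CX := (cfun R k X).
Local Notation CY := (cfun R k Y).

Lemma continuous_of_discrete (Z : topologicalType) (f : X -> Z) : continuous f.
Proof. by apply/continuousP => A _; exact: openX. Qed.

(** The indicators of points, indexed by a [finType] so that they can be summed. *)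
Definition atom (j : I) : CX :=
  cfun_of (continuous_of_discrete K (fun x => (ix x == j)%:R)).

Lemma cfun_atomsE (f : CX) : f = \sum_j f (pt j) *: atom j.
Proof.
apply: cfunP => x; rewrite cfun_sumE.
rewrite (eq_bigr (fun j => f (pt j) * (ix x == j)%:R))//.
rewrite (bigD1 (ix x))//= big1 => [|j jx].
  by rewrite addr0 ixK eqxx mulr1.
by rewrite eq_sym (negbTE jx) mulr0.
Qed.

Lemma linear_atomsE (T : {linear CX -> CY}) f y :
  T f y = \sum_j f (pt j) * T (atom j) y.
Proof.
rewrite {1}(cfun_atomsE f) linear_sum cfun_sumE.
by apply: eq_bigr => j _; rewrite linearZ.
Qed.

(** On [A], the value of [f] at [pt j] is a unimodular [u j] that turns [T (atom j) y] into its
    modulus, so no cancellation occurs in [T f y]. *)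
Lemma extremal_cfun (T : {linear CX -> CY}) (A : {set I}) y :
  exists f : CX, [/\ forall x, ix x \notin A -> f x = 0,
    forall x, ix x \in A -> modulus (f x) = 1 &
    modulus (T f y) = \sum_(j in A) modulus (T (atom j) y)].
Proof.
have /choice[u uP] j : exists u : K,
    modulus u = 1 /\ T (atom j) y * u = of_real k (modulus (T (atom j) y)).
  by have [u] := conj_phase_exists (T (atom j) y); exists u.
pose f : CX := cfun_of (continuous_of_discrete K
  (fun x => if ix x \in A then u (ix x) else 0)).
have fE x : f x = if ix x \in A then u (ix x) else 0 by [].
exists f; split=> [x|x|]; rewrite ?fE.
- by move/negbTE => ->.
- by move=> ->; have [] := uP (ix x).
rewrite linear_atomsE (eq_bigr (fun j =>
  if j \in A then of_real k (modulus (T (atom j) y)) else 0)).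
  rewrite -big_mkcond -of_real_sum modulus_of_real//.
  by apply: sumr_ge0 => j _; exact: modulus_ge0.
move=> j _; rewrite fE ptK; case: ifP => _; last by rewrite mul0r.
by rewrite mulrC; have [] := uP j.
Qed.

Lemma sum_modulus_le_opnorm (T : {linear CX -> CY}) y : opnorm T != 0 ->
  \sum_j modulus (T (atom j) y) <= opnorm T.
Proof.
(* The extremal function for the whole index set lies in the unit ball. *)
move=> T0; have [f [_ f1]] := extremal_cfun T [set: I]%SET y.
rewrite (eq_bigl predT) => [<-|j]; last by rewrite inE.
apply: le_trans (modulus_le_supnorm _ _) (supnorm_le_opnorm _ _ T0 _).
by apply: supnorm_le => // x; rewrite f1 ?inE.
Qed.

Lemma disjointness_preserving_partition (eps : R) (T : {linear CX -> CY})
    (A : {set I}) y : 0 <= eps -> disjointness_preserving eps T ->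
  (\sum_(j in A) modulus (T (atom j) y)) *
  (\sum_(j in ~: A) modulus (T (atom j) y)) <= eps.
Proof.
move=> eps0 [_ Tdp].
(* Empty sides are settled first: an extremal function has norm exactly 1 only if its support
   contains a point. *)
have [->|/set0Pn[a aA]] := eqVneq A finset.set0.
  by rewrite big_set0 mul0r.
have [->|/set0Pn[b bA]] := eqVneq (~: A) finset.set0.
  by rewrite big_set0 mulr0.
have [f [f0 f1 <-]] := extremal_cfun T A y.
have [g [g0 g1 <-]] := extremal_cfun T (~: A) y.
have norm1 (B : {set I}) (c : I) (p : CX) : c \in B ->
    (forall x, ix x \notin B -> p x = 0) ->
    (forall x, ix x \in B -> modulus (p x) = 1) -> supnorm p = 1.
  move=> cB p0 p1; apply/eqP; rewrite eq_le; apply/andP; split.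
    apply: supnorm_le => // x.
    by have [/p1->|/p0->] := boolP (ix x \in B); rewrite ?modulus0.
  by rewrite -(p1 (pt c)) ?ptK// modulus_le_supnorm.
rewrite -modulusM; apply: le_trans (modulus_le_supnorm (T f * T g) y) _.
apply: Tdp; [exact: norm1 aA f0 f1|exact: norm1 bA g0 g1|].
apply: cfunP => x; rewrite -[LHS]/(f x * g x).
have [xA|/f0->] := boolP (ix x \in A); last by rewrite mul0r.
by rewrite g0 ?mulr0// inE xA.
Qed.

(** Points of [X] are open, so [h] is locally constant and the function agrees near [y] with a
    single [F j]. *)
Lemma diagonal_continuous (F : I -> CY) (h : Y -> X) : continuous h ->
  continuous (fun y => F (ix (h y)) y).
Proof.
move=> hc y; set j := ix (h y).
apply: (@cvg_trans _ (F j z @[z --> y])); last exact: cfun_continuous.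
apply: near_eq_cvg.
have : nbhs y (h @^-1` [set h y]).
  by apply: hc; apply: open_nbhs_nbhs; split => //; exact: openX.
by apply: filterS => z /= hz; rewrite hz.
Qed.

(** Expanding [T f y] over the atoms, the subtracted product cancels the term at [x]; the other
    coefficients have modulus at most 1. *)
Lemma modulus_sub_atom_le (T : {linear CX -> CY}) (f : CX) (x : X) y :
  supnorm f <= 1 ->
  modulus (T f y - T (atom (ix x)) y * f x) <=
  \sum_j modulus (T (atom j) y) - modulus (T (atom (ix x)) y).
Proof.
move=> f1; rewrite linear_atomsE.
rewrite (bigD1 (ix x))//= ixK mulrC addrAC subrr add0r.
rewrite [leRHS](_ : _ = \sum_(j | j != ix x) modulus (T (atom j) y)); last first.
  by rewrite (bigD1 (ix x))//= addrAC subrr add0r.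
apply: le_trans (ler_modulus_sum _ _ _ _) _; apply: ler_sum => j _.
rewrite modulusM ler_piMl ?modulus_ge0//.
exact: le_trans (modulus_le_supnorm _ _) f1.
Qed.

End FiniteDomain.

(** * Extension of the maximal-weight selection from [D] to [Y] *)

Theorem theorem4p2 (R : realType) (k : scalar_kind) (eps : R)
    (heps : 0 < eps < 1 / 4)
    (D : discreteTopologicalType) (hD : exists d1 d2 : D, d1 <> d2)
    (Y : compactHausdorffType) (i : D -> Y) (hY : is_stone_cech i)
    (X : compactHausdorffType) (n : nat)
    (hX : ([set: X] #= `I_n)%card) (hn : (2 <= n)%N)
    (T : {linear cfun R k X -> cfun R k Y})
    (hT : disjointness_preserving eps T) (hT1 : opnorm T = 1) :
  exists S : {linear cfun R k X -> cfun R k Y},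
    weighted_composition S /\ opnorm (T \- S) <= o_prime n eps.
Proof.
have openX (A : set X) : open A.
  by apply: finite_hausdorff_open; [exact: hausdorffT|exists n].
have [ix [pt ptK ixK]] : exists ix : X -> 'I_n, exists2 pt : 'I_n -> X,
    cancel pt ix & cancel ix pt.
  have /card_set_bijP[r [rI rinj rsurj]] := hX.
  have rn x : (r x < n)%N by exact: rI.
  have /choice[pt ptP] (j : 'I_n) : exists x, r x = j.
    by have [x _ rx] := rsurj j (ltn_ord j); exists x.
  exists (fun x => Ordinal (rn x)), pt => [j|x]; first exact/val_inj/ptP.
  by apply: rinj; rewrite ?inE// ptP.
case: hY => _ _ dense_i extend_i.
pose e : 'I_n -> cfun R k X := atom (ix := ix) openX.
pose w d j := modulus (T (e j) (i d)).
pose j0 : 'I_n := Ordinal (ltnW hn).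
pose jmax d := [arg max_(j > j0) w d j]%O.
have jmaxP d j : w d j <= w d (jmax d).
  by rewrite /jmax; case: Order.TotalTheory.arg_maxP => // l _; apply.
have hc : continuous (fun d => pt (jmax d)).
  by apply/continuousP => A _; exact: discrete_open.
(* The universal property applies with target [X], itself compact Hausdorff. *)
have [h hcont hE] := extend_i _ _ hc.
pose a : cfun R k Y :=
  cfun_of (diagonal_continuous (ix := ix) openX (fun j => T (e j)) h hcont).
exists (wcomp a h hcont); split; first exact: wcomp_weighted_composition.
have ixh d : ix (h (i d)) = jmax d.
  by have /(congr1 (@^~ d)) /= -> := hE; rewrite ptK.
have T1 y : \sum_j modulus (T (e j) y) <= 1.
  by rewrite -hT1; apply: sum_modulus_le_opnorm; rewrite // hT1 oner_neq0.
have w_le d : \sum_j w d j - w d (jmax d) <= o_prime n eps.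
  rewrite -[in leRHS](card_ord n); apply: sum_sub_max_le; rewrite ?card_ord//.
  - by move=> j; rewrite modulus_ge0 jmaxP.
  - exact: T1.
  - move=> A; apply: disjointness_preserving_partition hT => //.
    by case/andP: heps => /ltW.
(* The point [d0] serves to derive [0 <= o_prime n eps] from [w_le d0]. *)
have [d0 _] := hD.
apply: opnorm_le => [|f y f1].
  apply: le_trans (w_le d0); rewrite subr_ge0 (bigD1 (jmax d0))//= lerDl.
  by apply: sumr_ge0 => j _; exact: modulus_ge0.
(* On the dense range of [i], the map [h] selects an index of maximal weight, so [w_le] applies
   there. *)
apply: (dense_modulus_le ((T \- wcomp a h hcont) f) _ _ dense_i) => _ [d _ <-].
apply: le_trans (w_le d); rewrite -ixh.
exact: modulus_sub_atom_le.
Qed.
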